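(* Let $n\ge 1$. All the metrics $d_{\mathcal B}^p$, $1\le p\le\infty$, induce the same topology on $\mathcal B^n$, and all the metrics $d_{\mathcal H}^p$, $1\le p\le \infty$, induce the same topology on $\mathcal H^n$. Both topologies coincide when restricted to $\mathcal H^n$; that is, the subspace topology on $\mathcal H^n\subseteq\mathcal B^n$ induced by $d_{\mathcal B}^p$ equals the topology on $\mathcal H^n$ induced by $d_{\mathcal H}^p$.
   Context: $K$ is a field with a non-trivial valuation $\mathrm{val}\colon K\to\mathbb R\cup\{\infty\}$, complete with respect to the associated non-Archimedean absolute value $|a|=\exp(-\mathrm{val}(a))$ (base fixed). $\hat K$ is the completion of an algebraic closure of $K$, with the unique extensions of $\mathrm{val}$ and $|\cdot|$. For $a\in K^n$, $r\in\mathbb R_{\ge0}^n$, $v\in(\mathbb R\cup\{\infty\})^n$ put $B_{\mathcal B}(a,r)=\{z\in\hat K^n: |a_i-z_i|\le r_i\ \forall i\}$ and $B_{\mathcal H}(a,v)=\{z\in\hat K^n:\mathrm{val}(a_i-z_i)\ge v_i\ \forall i\}$. Thus $B_{\mathcal B}(a,r)=B_{\mathcal H}(a,v)$ when $r_i=\exp(-v_i)$. $\mathcal B^n$ is the set of all $B_{\mathcal B}(a,r)$ with $a\in K^n$, $r\in\mathbb R_{\ge 0}^n$, and $\mathcal H^n\subseteq\mathcal B^n$ is the subset of those with $r\in\mathbb R_{>0}^n$ (equivalently $v\in\mathbb R^n$). Join on $\mathcal B^1$: for $B=B_{\mathcal B}(a,r)$, $B'=B_{\mathcal B}(a',r')$,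 $B\vee B'=B\cup B'$ if one contains the other, and $B\vee B'=B_{\mathcal B}(a,|a-a'|)$ otherwise. Metrics for $n=1$: for $B=B_{\mathcal B}(a,r)=B_{\mathcal H}(a,v)$ and $B'=B_{\mathcal B}(a',r')=B_{\mathcal H}(a',v')$, if one contains the other then $d_{\mathcal B}(B,B')=|r-r'|$ (on $\mathcal B^1$) and $d_{\mathcal H}(B,B')=|v-v'|$ (on $\mathcal H^1$). Otherwise $d_\bullet(B,B')=d_\bullet(B,B\vee B')+d_\bullet(B\vee B',B')$ for $\bullet\in\{\mathcal B,\mathcal H\}$. For $B=B_1\times\dots\times B_n$, $B'=B'_1\times\dots\times B'_n$, $d_\bullet^p(B,B')=\big(\sum_i d_\bullet(B_i,B_i')^p\big)^{1/p}$ (the maximum of the $d_\bullet(B_i,B_i')$ if $p=\infty$). *)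

(* Defs.v *)
From HB Require Import structures.
From mathcomp Require Import all_boot all_order all_algebra.
From mathcomp Require Import all_classical all_reals all_analysis.

Set Implicit Arguments.
Unset Strict Implicit.
Unset Printing Implicit Defensive.

Import Order.TTheory GRing.Theory Num.Theory.
Local Open Scope classical_set_scope.
Local Open Scope ring_scope.

Definition valuation (R : realType) (F : fieldType) (v : F -> \bar R) : Prop :=
  [/\ forall x, v x <> -oo%E,
      forall x, v x = +oo%E <-> x = 0,
      forall x y, v (x * y)%R = (v x + v y)%E &
      forall x y, (Order.min (v x) (v y) <= v (x + y)%R)%E].

Definition nontrivial_valuation (R : realType) (F : fieldType)
    (v : F -> \bar R) : Prop :=
  exists2 x, x != 0 & v x <> 0%E.

(* [exp_base b w] is exp(-w) for the exponential of base [b], with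
   exp(-oo) = 0; the value at [w = -oo] is junk. *)
Definition exp_base (R : realType) (b : R) (w : \bar R) : R :=
  if w is w'%:E then b `^ (- w') else 0.

Definition absv (R : realType) (b : R) (F : fieldType) (v : F -> \bar R)
  (x : F) : R := exp_base b (v x).

Definition complete_for (R : realType) (F : fieldType) (N : F -> R) : Prop :=
  forall u : nat -> F,
    (forall e : R, 0 < e -> exists M : nat, forall i j : nat,
       (M <= i)%N -> (M <= j)%N -> N (u i - u j) < e) ->
    exists l : F, forall e : R, 0 < e -> exists M : nat, forall i : nat,
      (M <= i)%N -> N (u i - l) < e.

Definition algebraic_closure (K L : fieldType) (f : {rmorphism K -> L}) : Prop :=
  GRing.closed_field_axiom L /\ forall x : L, algebraicOver f x.

(* [Khat], with [emb] and [valh], is a completion of some algebraic closure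
   [L] of [K]; the extension of the valuation to [L] is [valh \o j]. *)
Definition completed_algebraic_closure (R : realType) (b : R)
    (K Khat : fieldType) (val : K -> \bar R) (valh : Khat -> \bar R)
    (emb : {rmorphism K -> Khat}) : Prop :=
  [/\ valuation valh,
      forall a, valh (emb a) = val a,
      complete_for (absv b valh) &
      exists (L : fieldType) (f : {rmorphism K -> L}) (j : {rmorphism L -> Khat}),
        [/\ algebraic_closure f,
            forall a, j (f a) = emb a &
            forall (x : Khat) (e : R), 0 < e ->
              exists y : L, absv b valh (x - j y) < e]].

Section Balls.
Variables (R : realType) (b : R) (K Khat : fieldType).
Variables (valh : Khat -> \bar R) (emb : {rmorphism K -> Khat}).

Definition ballB1 (a : K) (r : R) : set Khat :=
  [set z | absv b valh (emb a - z) <= r].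

Definition ballH1 (a : K) (v : \bar R) : set Khat :=
  [set z | (v <= valh (emb a - z)%R)%E].

Definition ballB (n : nat) (a : 'rV[K]_n) (r : 'rV[R]_n) : set 'rV[Khat]_n :=
  [set z | forall i, absv b valh (emb (a 0 i) - z 0 i) <= r 0 i].

Definition Bn (n : nat) : set (set 'rV[Khat]_n) :=
  [set B | exists (a : 'rV[K]_n) (r : 'rV[R]_n),
      (forall i, 0 <= r 0 i) /\ B = ballB a r].

Definition Hn (n : nat) : set (set 'rV[Khat]_n) :=
  [set B | exists (a : 'rV[K]_n) (r : 'rV[R]_n),
      (forall i, 0 < r 0 i) /\ B = ballB a r].

(* The center and the radii of a ball are chosen among its presentations.
   The radii do not depend on the choice, because the value group of [Khat]
   is dense; the center does, but the join below does not. *)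
Definition presB (B : set Khat) : K * R :=
  xget (0, 0) [set ar | 0 <= ar.2 /\ B = ballB1 ar.1 ar.2].
Definition center (B : set Khat) : K := (presB B).1.
Definition radB (B : set Khat) : R := (presB B).2.
Definition radH (B : set Khat) : R :=
  xget 0 [set v | exists a, B = ballH1 a v%:E].

Definition join (B B' : set Khat) : set Khat :=
  if `[< B `<=` B' \/ B' `<=` B >] then B `|` B'
  else ballB1 (center B)
         (absv b valh (emb (center B - center B'))).

Definition tree_dist (rad : set Khat -> R) (B B' : set Khat) : R :=
  if `[< B `<=` B' \/ B' `<=` B >] then `|rad B - rad B'|
  else `|rad B - rad (join B B')| + `|rad (join B B') - rad B'|.

Definition dB1 : set Khat -> set Khat -> R := tree_dist radB.
Definition dH1 : set Khat -> set Khat -> R := tree_dist radH.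

(* The factor [B_i] of a product [B = B_1 x ... x B_n] of nonempty sets. *)
Definition factor (n : nat) (B : set 'rV[Khat]_n) (i : 'I_n) : set Khat :=
  [set z 0 i | z in B].

(* Meant for [1 <= p]; the value at [p = -oo] is junk. *)
Definition prod_dist (d : set Khat -> set Khat -> R) (n : nat) (p : \bar R)
    (B B' : set 'rV[Khat]_n) : R :=
  match p with
  | q%:E => (\sum_(i < n) d (factor B i) (factor B' i) `^ q) `^ q^-1
  | +oo%E => \big[Num.max/0]_(i < n) d (factor B i) (factor B' i)
  | -oo%E => 0
  end.

Definition dB (n : nat) := @prod_dist dB1 n.
Definition dH (n : nat) := @prod_dist dH1 n.

End Balls.

Arguments Bn {R} b {K Khat} valh emb n.
Arguments Hn {R} b {K Khat} valh emb n.
Arguments dB {R} b {K Khat} valh emb {n} p B B'.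
Arguments dH {R} b {K Khat} valh emb {n} p B B'.

(* The family of open subsets of [X] for the distance [d] on [X]. *)
Definition metric_topology (R : realType) (T : Type) (X : set T)
    (d : T -> T -> R) : set (set T) :=
  [set U | U `<=` X /\ forall x, U x ->
     exists2 e : R, 0 < e & forall y, X y -> d x y < e -> U y].

Definition subspace_topology (T : Type) (Y : set T) (tau : set (set T)) :
  set (set T) := [set V `&` Y | V in tau].

(* Main.v *)
(* For every [p] a ball of the product distance lies between two boxes, so its
   topology depends only on the distances of the factors. On balls of positive
   radius the two radii determine each other through the homeomorphism
   [r |-> - log_b r], and both distances are the same sums of differences of
   radii along the join, so each is small near a fixed ball as soon as the other
   is. Finally [|r - r'| <= d_B (B, B')] makes [H^n] open in [B^n], so that the
   subspace topology is the topology of the restricted distance. That a ball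
   determines its radius rests on the density of the value group of [Khat]. *)
Require Import Defs.
From mathcomp Require Import all_boot all_order all_algebra.
From mathcomp Require Import all_classical all_reals all_analysis.
From mathcomp Require Import ring lra.
Import Order.TTheory GRing.Theory Num.Theory.
Import numFieldNormedType.Exports.
Local Open Scope classical_set_scope.
Local Open Scope ring_scope.

(** * Non-Archimedean absolute values and the density of the value group *)

Section AbsoluteValue.
Context {R : realType} {b : R} {F : fieldType} {v : F -> \bar R}.
Hypotheses (b_gt1 : 1 < b) (vv : valuation v).

Lemma exp_base_ge0 (w : \bar R) : 0 <= exp_base b w.
Proof. by case: w => [w| |] //=; exact: powR_ge0. Qed.

(** The junk value 0 at [-oo] would break monotonicity, so [u] must avoid it; [w] then avoids it
    too. *)
Lemma exp_base_anti (u w : \bar R) :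
  u <> -oo%E -> (u <= w)%E -> exp_base b w <= exp_base b u.
Proof.
move=> uN; case: w => [w| |] /=; last by rewrite leeNy_eq => /eqP.
- case: u uN => [u| |] //= _; rewrite lee_fin => uw.
  by apply: ler_powR; [exact: ltW | rewrite lerN2].
- by move=> _; exact: exp_base_ge0.
Qed.

Lemma absv0 : absv b v 0 = 0.
Proof. by case: vv => _ /(_ 0)[_ v0] _ _; rewrite /absv v0. Qed.

Lemma absv_gt0 x : x != 0 -> 0 < absv b v x.
Proof.
case: vv => vN /(_ x)[v0 _] _ _ x0; rewrite /absv.
case: (v x) (vN x) v0 => [w _ _| _ /(_ erefl) xE|] //=.
- by apply: powR_gt0; exact: lt_trans ltr01 b_gt1.
- by rewrite xE eqxx in x0.
Qed.

Lemma absvM x y : absv b v (x * y) = absv b v x * absv b v y.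
Proof.
case: vv => vN _ vM _; rewrite /absv vM.
case: (v x) (vN x) => [s _|_|] //; case: (v y) (vN y) => [t _|_|] //=;
  rewrite ?mulr0 ?mul0r //.
rewrite opprD powRD //.
by rewrite (gt_eqF (lt_trans ltr01 b_gt1)) implybT.
Qed.

Lemma absv1 : absv b v 1 = 1.
Proof.
have h := absv_gt0 _ (oner_neq0 F).
by apply: (mulfI (lt0r_neq0 h)); rewrite -absvM !mulr1.
Qed.

Lemma absvX x n : absv b v (x ^+ n) = absv b v x ^+ n.
Proof. by elim: n => [|n IH]; rewrite ?expr0 ?absv1 // !exprS absvM IH. Qed.

Lemma absvN x : absv b v (- x) = absv b v x.
Proof.
rewrite -mulN1r absvM; suff -> : absv b v (-1) = 1 by rewrite mul1r.
have /eqP : absv b v (-1) ^+ 2 = 1 by rewrite -absvX sqrrN expr1n absv1.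
rewrite sqrf_eq1 => /orP[/eqP //|/eqP h].
by have := exp_base_ge0 (v (-1)); rewrite -/(absv b v (-1)) h ler0N1.
Qed.

Lemma absvD_le x y s :
  absv b v x <= s -> absv b v y <= s -> absv b v (x + y) <= s.
Proof.
case: vv => vN _ _ /(_ x y) vD xs ys.
move: vD; rewrite minEle; case: ifP => _ /exp_base_anti h.
- exact: le_trans (h (vN _)) xs.
- exact: le_trans (h (vN _)) ys.
Qed.

Lemma absvB_le x y s :
  absv b v x <= s -> absv b v y <= s -> absv b v (x - y) <= s.
Proof. by move=> xs ys; apply: absvD_le => //; rewrite absvN. Qed.

(** Serves to give a power of a root a prescribed rational multiple of a logarithm. *)
Lemma ln_absv_exprz x (z : int) : x != 0 ->
  ln (absv b v (x ^ z)) = z%:~R * ln (absv b v x).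
Proof.
move=> x0; have h := absv_gt0 _ x0; case: z => n.
- by rewrite -exprnP absvX lnXn // mulr_natl.
- have xn0 : x ^+ n.+1 != 0 by rewrite expf_neq0.
  have g := absv_gt0 _ xn0.
  rewrite NegzE -exprnN mulrNz mulNr.
  have -> : absv b v (x ^- n.+1) = (absv b v (x ^+ n.+1))^-1.
    by apply: (mulfI (lt0r_neq0 g)); rewrite -absvM !mulfV ?absv1 // lt0r_neq0.
  by rewrite lnV ?posrE // absvX lnXn // mulr_natl.
Qed.

End AbsoluteValue.

(* Roots of one element of absolute value different from 1 already give a
   dense group of values. *)
Lemma absv_dense (R : realType) (b : R) (K Khat : fieldType)
    (val : K -> \bar R) (valh : Khat -> \bar R) (emb : {rmorphism K -> Khat})
    (s r : R) :
  1 < b -> nontrivial_valuation val ->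
  completed_algebraic_closure b val valh emb -> 0 <= s -> s < r ->
  exists x : Khat, s < absv b valh x < r.
Proof.
move=> b1 [x0 x00 vx0] [vv vE _ [L [f [j [[cL _] jf _]]]]] s_ge0 sr.
(* Logarithms need a positive lower bound; for [s = 0] the bound [r / 2] does. *)
wlog s_gt0 : s s_ge0 sr / 0 < s.
  move=> H; have [s0|s0] := ltP 0 s; first exact: H.
  have s_eq : s = 0 by apply/eqP; rewrite eq_le s0 s_ge0.
  case: (H (r / 2)) => [|||x /andP[h1 h2]]; [lra|lra|lra|].
  by exists x; rewrite h2 andbT; lra.
have r_gt0 : 0 < r by exact: lt_trans sr.
have e0 : emb x0 != 0 by rewrite fmorph_eq0.
have T_gt0 := absv_gt0 b1 vv _ e0.
set T := absv b valh (emb x0) in T_gt0.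
have lnT : ln T != 0.
  rewrite /T /absv vE; case: (val x0) vx0 (vE x0) => [w||] wN0 vE0.
  - rewrite /= ln_powR mulf_neq0 ?oppr_eq0 //.
      by apply/eqP => w0; apply: wN0; rewrite w0.
    by rewrite gt_eqF // ln_gt0.
  - case: vv => _ /(_ (emb x0))[h _] _ _.
    by rewrite (h vE0) eqxx in e0.
  - by case: vv => /(_ (emb x0)).
(* The aim is an element of absolute value [T] to the power [q]. As [ln T] may be negative, dividing
   by it may reverse the bounds. *)
have [q] : exists q : rat, ln s < ratr q * ln T < ln r.
  have lsr : ln s < ln r by rewrite ltr_ln.
  case: (ltgtP (ln T) 0) lnT => // lnT _.
  - have [|q] := @rat_in_itvoo R (ln r / ln T) (ln s / ln T).
      by rewrite ltr_nM2r // invr_lt0.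
    rewrite in_itv /= => /andP[h1 h2]; exists q.
    by rewrite -ltr_ndivlMr // h2 -ltr_ndivrMr.
  - have [|q] := @rat_in_itvoo R (ln s / ln T) (ln r / ln T).
      by rewrite ltr_pM2r // invr_gt0.
    rewrite in_itv /= => /andP[h1 h2]; exists q.
    by rewrite -ltr_pdivlMr // h2 -ltr_pdivrMr // h1.
case: (denqP q) => d dE /andP[q1 q2].
(* With only the constant coefficient nonzero, the closed field axiom yields a root of [f x0] whose
   order [d.+1] is the denominator of [q]. *)
have [y yE] := cL d.+1 (fun i => if i == 0%N then f x0 else 0) isT.
have {}yE : y ^+ d.+1 = f x0.
  rewrite yE big_ord_recl /= mulr1 big1 ?addr0 // => i _.
  by rewrite mul0r.
have jyE : j y ^+ d.+1 = emb x0 by rewrite -rmorphXn yE jf.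
have jy0 : j y != 0.
  by apply: contra_neq e0 => h; rewrite -jyE h expr0n.
have lnjy : d.+1%:R * ln (absv b valh (j y)) = ln T.
  by rewrite /T -jyE absvX // lnXn ?absv_gt0 // mulr_natl.
have lnz : ln (absv b valh (j y ^ numq q)) = ratr q * ln T.
  rewrite ln_absv_exprz // -lnjy /ratr dE mulrA; congr (_ * _).
  by rewrite mulfVK // pnatr_eq0.
have zpos : absv b valh (j y ^ numq q) \is Num.pos.
  by rewrite posrE absv_gt0 // expfz_neq0.
by exists (j y ^ numq q); apply/andP; split; rewrite -ltr_ln ?lnz.
Qed.

(** * Topologies of product distances *)

Section ProductTopology.
Context {R : realType}.

(** The minimum of finitely many positive radii is positive; starting it at 1 covers [n = 0]. *)
Lemma min_radius n (P : 'I_n -> R -> Prop) :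
  (forall i e e', P i e -> e' <= e -> P i e') ->
  (forall i, exists2 e : R, 0 < e & P i e) ->
  exists2 e : R, 0 < e & forall i, P i e.
Proof.
move=> Pdown Pex.
have [f fP] := choice (fun i => let: ex_intro2 e h k := Pex i in
  ex_intro (fun e => 0 < e /\ P i e) e (conj h k)).
exists (\big[Order.min/1]_i f i).
  by apply: lt_bigmin => // i _; case: (fP i).
by move=> i; have [_ /Pdown] := fP i; apply; exact: bigmin_le.
Qed.

(** The hypothesis is continuity of the identity from [d'] to [d]. *)
Lemma metric_topologyS (T : Type) (X : set T) (d d' : T -> T -> R) :
  (forall x e, X x -> 0 < e ->
     exists2 e', 0 < e' & forall y, X y -> d' x y < e' -> d x y < e) ->
  metric_topology X d `<=` metric_topology X d'.
Proof.
move=> H U [UX Uo]; split=> // x Ux.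
have [e e0 eU] := Uo x Ux.
have [e' e'0 e'e] := H x e (UX _ Ux) e0.
by exists e' => // y Xy /e'e h; apply: eU => //; exact: h.
Qed.

(** As [Y] is open in [X], an open subset of [Y] is already open in [X] and is its own trace. *)
Lemma subspace_metric_topology (T : Type) (X Y : set T) (d : T -> T -> R) :
  metric_topology X d Y ->
  subspace_topology Y (metric_topology X d) = metric_topology Y d.
Proof.
move=> [YX Yo]; apply/seteqP; split=> [_ [U [UX Uo] <-]|V [VY Vo]].
- split=> [|x [Ux Yx]]; first exact: subIsetr.
  have [e e0 eU] := Uo x Ux; exists e => // y Yy dxy.
  by split=> //; apply: eU => //; exact: YX.
- exists V; last exact: setIidl.
  split=> [|x Vx]; first exact: subset_trans YX.
  have [e e0 eV] := Vo x Vx; have [e' e'0 e'Y] := Yo x (VY _ Vx).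
  exists (Num.min e e'); first by rewrite lt_min e0.
  by move=> y Xy; rewrite lt_min => /andP[ye ye']; apply: eV => //; exact: e'Y.
Qed.

Context {F : fieldType}.
(* [all_analysis] shadows some names of [Defs]. *)
Local Notation factor := Defs.factor.
Local Notation prod_dist d p := (@prod_dist R F d _ p).

Lemma factor_lt_prod_dist (d : set F -> set F -> R) n (p : \bar R)
    (B B' : set 'rV[F]_n) e :
  (forall A A', 0 <= d A A') -> (1 <= p)%E -> prod_dist d p B B' < e ->
  forall i, d (factor B i) (factor B' i) < e.
Proof.
move=> d0; case: p => [q| |] //=.
- rewrite lee_fin => q1 h i; apply: le_lt_trans h.
  have q0 : 0 < q by exact: lt_le_trans q1.
  (* The distance is rewritten as the [1/q]-th power of its [q]-th power, which is one term of the
     sum. *)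
  rewrite -[leLHS]powRr1 // -[X in _ `^ X](mulfV (lt0r_neq0 q0)) powRrM.
  apply: ge0_ler_powR; rewrite ?invr_ge0 ?nnegrE ?powR_ge0 ?(ltW q0) //.
    by apply: sumr_ge0 => k _; exact: powR_ge0.
  by rewrite (bigD1 i) //= lerDl sumr_ge0 // => k _; exact: powR_ge0.
- by move=> _ /bigmax_ltP[_ h] i; exact: h.
Qed.

Lemma prod_dist_lt (d : set F -> set F -> R) n (p : \bar R) e :
  (forall A A', 0 <= d A A') -> (1 <= p)%E -> 0 < e ->
  exists2 e', 0 < e' & forall B B' : set 'rV[F]_n,
    (forall i, d (factor B i) (factor B' i) < e') -> prod_dist d p B B' < e.
Proof.
move=> d0; case: p => [q| |] //= q1 e0; last first.
  by exists e => // B B' h; apply/bigmax_ltP; split.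
rewrite lee_fin in q1; have q0 : 0 < q by exact: lt_le_trans q1.
have n0 : 0 < n.+1%:R :> R by rewrite ltr0n.
(* Since [q >= 1], each of the [n] terms is at most [e^q / (n+1)]; dividing by [n+1] instead of [n]
   makes the bound on the sum strict and allows [n = 0]. *)
exists (e / n.+1%:R) => [|B B' h]; first exact: divr_gt0.
rewrite -[ltRHS](powRr1 (ltW e0)).
rewrite -[X in _ < _ `^ X](mulfV (lt0r_neq0 q0)) powRrM.
apply: gt0_ltr_powR; rewrite ?invr_gt0 ?nnegrE ?powR_ge0 //.
  by apply: sumr_ge0 => k _; exact: powR_ge0.
apply: (@le_lt_trans _ _ (\sum_(i < n) e `^ q / n.+1%:R)).
  apply: ler_sum => i _; apply: (@le_trans _ _ ((e / n.+1%:R) `^ q)).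
    by apply: ge0_ler_powR; rewrite ?nnegrE ?divr_ge0 ?d0 ?ltW.
  rewrite powRM ?invr_ge0 ?(ltW e0) ?(ltW n0) //.
  apply: ler_wpM2l; first exact: powR_ge0.
  rewrite -[leRHS]powRr1 ?invr_ge0 ?(ltW n0) //.
  by apply: ger_powR => //; rewrite invr_gt0 n0 invf_le1 // ler1n.
rewrite sumr_const card_ord -[_ *+ n]mulr_natr -mulrA gtr_pMr ?powR_gt0 //.
by rewrite mulrC ltr_pdivrMr // mul1r ltr_nat.
Qed.

(** Smallness passes from the product to the factors, from [d'] to [d] there, and back to the
    product. Taking [d = d'] changes the exponent; taking [p = q] changes the distance. *)
Lemma metric_topology_prodS (d d' : set F -> set F -> R) n
    (X : set (set 'rV[F]_n)) (p q : \bar R) :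
  (forall A A', 0 <= d A A') -> (forall A A', 0 <= d' A A') ->
  (1 <= p)%E -> (1 <= q)%E ->
  (forall x i e, X x -> 0 < e -> exists2 e', 0 < e' & forall y, X y ->
     d' (factor x i) (factor y i) < e' -> d (factor x i) (factor y i) < e) ->
  metric_topology X (prod_dist d p) `<=`
    metric_topology X (prod_dist d' q).
Proof.
move=> d0 d'0 p1 q1 H; apply: metric_topologyS => x e Xx e0.
have [e1 e10 e1P] := prod_dist_lt _ n _ _ d0 p1 e0.
have [|i|e2 e20 e2P] := @min_radius n (fun i e' => forall y, X y ->
     d' (factor x i) (factor y i) < e' -> d (factor x i) (factor y i) < e1).
- by move=> i u u' hu u'u y Xy h; apply: hu => //; exact: lt_le_trans u'u.
- exact: H.
exists e2 => // y Xy xy; apply: e1P => i; apply: e2P => //.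
exact: (factor_lt_prod_dist _ _ _ _ _ _ d'0 q1 xy i).
Qed.

End ProductTopology.

(** * Balls, their radii and the tree distances *)

Definition rad_of_val {R : realType} (b w : R) : R := expR (- (w * ln b)).
Definition val_of_rad {R : realType} (b r : R) : R := - (ln r / ln b).

(** The elements of H^1 as subsets of [Khat] itself, the form taken by the factors of elements of
    [Hn]. *)
Definition pos_ball {R : realType} (b : R) {K Khat : fieldType}
    (valh : Khat -> \bar R) (emb : {rmorphism K -> Khat}) (B : set Khat) :=
  exists a r, 0 < r /\ B = ballB1 b valh emb a r.

Section Balls.
Context {R : realType} {b : R} {K Khat : fieldType}.
Context {val : K -> \bar R} {valh : Khat -> \bar R}.
Context {emb : {rmorphism K -> Khat}}.
Hypotheses (b_gt1 : 1 < b) (val_nontrivial : nontrivial_valuation val).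
Hypothesis (Khat_completion : completed_algebraic_closure b val valh emb).

Local Notation abs := (absv b valh).
Local Notation ball := (ballB1 b valh emb).
Local Notation factor := Defs.factor.
Local Notation center := (Defs.center b valh emb).
Local Notation join := (Defs.join b valh emb).
Local Notation radB := (Defs.radB b valh emb).
Local Notation radH := (Defs.radH valh emb).
Local Notation tree_dist := (Defs.tree_dist b valh emb).

Let valhP : valuation valh. Proof. by case: Khat_completion. Qed.

(** If [r < r'], density gives [x] of absolute value strictly between them. Both [a'] and [a' - x]
    lie in the ball of radius [r'], but their difference is too large for one of radius [r]. *)
Lemma ballB1_inj_rad a a' r r' :
  0 <= r -> 0 <= r' -> ball a r = ball a' r' -> r = r'.
Proof.
wlog rr' : a a' r r' / r < r'.
  move=> H r0 r'0 E; have [rr'|rr'|//] := ltgtP r r'; first exact: (H a a').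
  by apply/esym/(H a' a).
move=> r0 r'0 E.
have [x /andP[rx xr']] :=
  absv_dense _ _ _ _ _ _ _ _ _ b_gt1 val_nontrivial Khat_completion r0 rr'.
have ca : abs (emb a - emb a') <= r.
  have : ball a' r' (emb a'); last by rewrite -E.
  by rewrite /ballB1 /= subrr absv0.
have cx : abs (emb a - (emb a' - x)) <= r.
  have : ball a' r' (emb a' - x); last by rewrite -E.
  by rewrite /ballB1 /= subKr ltW.
have : abs x <= r.
  rewrite (_ : x = emb a - (emb a' - x) - (emb a - emb a')); last by ring.
  exact: absvB_le.
by rewrite leNgt rx.
Qed.

Lemma presB_ball a r : 0 <= r ->
  0 <= radB (ball a r) /\
  ball a r = ball (center (ball a r)) (radB (ball a r)).
Proof.
move=> r0; exact: (xgetPex (0, 0) (ex_intro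
  (fun ar : K * R => 0 <= ar.2 /\ ball a r = ball ar.1 ar.2)
  (a, r) (conj r0 erefl))).
Qed.

Lemma radB_ball a r : 0 <= r -> radB (ball a r) = r.
Proof.
move=> r0; have [c0 E] := presB_ball a _ r0.
exact/esym/(ballB1_inj_rad _ _ _ _ r0 c0 E).
Qed.

Lemma ballB1_subset a r r' : r <= r' -> ball a r `<=` ball a r'.
Proof. by move=> rr' z /= /le_trans; apply. Qed.

Let lnb_gt0 : 0 < ln b. Proof. exact: ln_gt0. Qed.

Lemma rad_of_val_powR w : b `^ (- w) = rad_of_val b w.
Proof. by rewrite /powR gt_eqF ?(lt_trans ltr01) // mulNr. Qed.

Lemma ballH1E a w : ballH1 valh emb a w%:E = ball a (rad_of_val b w).
Proof.
rewrite -rad_of_val_powR; apply/seteqP; rewrite /ballH1 /ballB1 /absv.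
split=> z /=; case: valhP => /(_ (emb a - z)) N _ _ _.
  by move/(exp_base_anti b_gt1); apply.
case: (valh _) N => [t _|_|] //=; last by rewrite leey.
rewrite lee_fin; apply: contraTT; rewrite -!ltNge => tw.
by rewrite !rad_of_val_powR ltr_expR ltrN2 ltr_pM2r.
Qed.

Lemma val_of_radK r : 0 < r -> rad_of_val b (val_of_rad b r) = r.
Proof.
move=> r0; rewrite /rad_of_val /val_of_rad mulNr opprK divfK ?lnK //.
by rewrite gt_eqF.
Qed.

Lemma rad_of_valK : cancel (rad_of_val b) (val_of_rad b).
Proof.
move=> w; rewrite /rad_of_val /val_of_rad expRK mulNr opprK mulfK //.
by rewrite gt_eqF.
Qed.

Lemma radH_ball a r : 0 < r -> radH (ball a r) = val_of_rad b r.
Proof.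
move=> r0; rewrite /Defs.radH; case: xgetP => [w _ [a' /esym]|].
  rewrite ballH1E => /ballB1_inj_rad <-; first by rewrite rad_of_valK.
    exact: expR_ge0.
  exact: ltW.
(* The default value of [xget] is excluded, because a presentation exists. *)
move=> /(_ (val_of_rad b r)); case; exists a.
by rewrite ballH1E val_of_radK.
Qed.

(** A join of radius 0 would mean equal centers, and concentric balls are nested. Thus the relation
    between the two radii also applies to the join. *)
Lemma pos_ball_join B B' : pos_ball b valh emb B -> pos_ball b valh emb B' ->
  ~ (B `<=` B' \/ B' `<=` B) -> pos_ball b valh emb (join B B').
Proof.
move=> [a [r [r0 BE]]] [a' [r' [r'0 BE']]] nc.
rewrite /Defs.join; case: asboolP => // _.
exists (center B), (abs (emb (center B - center B'))); split=> //.
apply: (absv_gt0 b_gt1 valhP); rewrite fmorph_eq0 subr_eq0.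
apply: contra_notN nc => /eqP.
have [_] := presB_ball a _ (ltW r0); have [_] := presB_ball a' _ (ltW r'0).
rewrite -BE -BE' => EB' EB cE.
have [rr'|rr'] := leP (radB B) (radB B').
- by left; rewrite EB EB' -cE; exact: ballB1_subset.
- by right; rewrite EB EB' -cE; apply: ballB1_subset; exact: ltW.
Qed.

Lemma tree_dist_ge0 rad B B' : 0 <= tree_dist rad B B'.
Proof. by rewrite /Defs.tree_dist; case: ifP => _; rewrite ?addr_ge0. Qed.

Lemma dist_rad_le_tree_dist rad B B' :
  `|rad B - rad B'| <= tree_dist rad B B'.
Proof. by rewrite /Defs.tree_dist; case: ifP => // _; exact: ler_distD. Qed.

(** If [B'] is near [B], the radii of [B'] and of the join are both near [rad B], so [phi] moves
    each by less than [e / 3]. The leg from [B] to the join then costs less than [e / 3], and the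
    leg from the join to [B'] less than twice that. *)
Lemma tree_dist_continuous (rad rad' : set Khat -> R) (phi : R -> R) B e :
  (forall A, pos_ball b valh emb A -> rad' A = phi (rad A)) ->
  {for rad B, continuous phi} -> pos_ball b valh emb B -> 0 < e ->
  exists2 e', 0 < e' & forall B', pos_ball b valh emb B' ->
    tree_dist rad B B' < e' -> tree_dist rad' B B' < e.
Proof.
move=> radE phic pB e0.
have e30 : 0 < e / 3 by rewrite divr_gt0.
have /cvgrPdist_lt/(_ _ e30)/nbhs_ballP[d d0 dP] := phic.
have {}dP t : `|rad B - t| < d -> `|phi (rad B) - phi t| < e / 3.
  exact: dP.
exists d => // B' pB' h.
have /dP hB' := le_lt_trans (dist_rad_le_tree_dist rad B B') h.
move: h; rewrite /Defs.tree_dist; case: asboolP => [_ _|nc h].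
  by rewrite !radE //; lra.
rewrite !radE //; last exact: pos_ball_join.
have /dP hM : `|rad B - rad (join B B')| < d.
  by apply: le_lt_trans h; rewrite lerDl.
have := ler_distD (phi (rad B)) (phi (rad (join B B'))) (phi (rad B')).
rewrite (distrC _ (phi (rad B))).
lra.
Qed.

Lemma factor_ballB n (a : 'rV[K]_n) (r : 'rV[R]_n) i : (forall j, 0 <= r 0 j) ->
  factor (ballB b valh emb a r) i = ball (a 0 i) (r 0 i).
Proof.
move=> r0; apply/seteqP; split=> [_ [z zB <-]|z0 z0B]; first exact: zB.
(* The other coordinates are put at the center, which is in the ball as radii are nonnegative. *)
exists (\row_j if j == i then z0 else emb (a 0 j)); last by rewrite mxE eqxx.
move=> j; rewrite mxE; case: eqP => [->//|_].
by rewrite subrr (absv0 valhP).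
Qed.

Lemma Hn_sub_Bn n : Hn b valh emb n `<=` Bn b valh emb n.
Proof. by move=> _ [a [r [r0 ->]]]; exists a, r; split=> // i; exact: ltW. Qed.

Lemma pos_ball_factor n B i :
  Hn b valh emb n B -> pos_ball b valh emb (factor B i).
Proof.
move=> [a [r [r0 ->]]]; exists (a 0 i), (r 0 i); split=> //.
by rewrite factor_ballB // => j; exact: ltW.
Qed.

Lemma Hn_open n p : (1 <= p)%E ->
  metric_topology (Bn b valh emb n) (dB b valh emb p) (Hn b valh emb n).
Proof.
move=> p1; split=> [|_ [a [r [r0 ->]]]]; first exact: Hn_sub_Bn.
have [|i|e e0 eP] := @min_radius R n (fun i e => e <= r 0 i).
- by move=> i u u' ur /le_trans; apply.
- by exists (r 0 i).
(* Each radius changes by less than [e], hence by less than itself, and stays positive. *)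
exists e => // _ [a' [r' [r'0 ->]]] h; exists a', r'; split=> // i.
have {}h := factor_lt_prod_dist _ _ _ _ _ _ (tree_dist_ge0 _) p1 h i.
have := le_lt_trans (dist_rad_le_tree_dist _ _ _) h.
rewrite !factor_ballB //; last by move=> j; exact: ltW.
rewrite !radB_ball // ?ltW // => h1.
have := ler_norm (r 0 i - r' 0 i); have := eP i; lra.
Qed.

End Balls.

(** * Comparison of the topologies *)

Theorem lemma9 (R : realType) (b : R) (K Khat : fieldType)
    (val : K -> \bar R) (valh : Khat -> \bar R) (emb : {rmorphism K -> Khat})
    (n : nat)
    (b_gt1 : 1 < b)
    (val_valuation : valuation val)
    (val_nontrivial : nontrivial_valuation val)
    (K_complete : complete_for (absv b val))
    (Khat_completion : completed_algebraic_closure b val valh emb)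
    (n_ge1 : (1 <= n)%N) :
  [/\ forall p q : \bar R, (1 <= p)%E -> (1 <= q)%E ->
        metric_topology (Bn b valh emb n) (dB b valh emb p) =
        metric_topology (Bn b valh emb n) (dB b valh emb q),
      forall p q : \bar R, (1 <= p)%E -> (1 <= q)%E ->
        metric_topology (Hn b valh emb n) (dH b valh emb p) =
        metric_topology (Hn b valh emb n) (dH b valh emb q) &
      forall p : \bar R, (1 <= p)%E ->
        subspace_topology (Hn b valh emb n)
          (metric_topology (Bn b valh emb n) (dB b valh emb p)) =
        metric_topology (Hn b valh emb n) (dH b valh emb p)].
Proof.
have dB0 := @tree_dist_ge0 _ b _ _ valh emb (radB b valh emb).
have dH0 := @tree_dist_ge0 _ b _ _ valh emb (radH valh emb).
split=> [p q p1 q1|p q p1 q1|p p1].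
- by apply/seteqP; split; apply: metric_topology_prodS => // x i e _ e0;
    exists e.
- by apply/seteqP; split; apply: metric_topology_prodS => // x i e _ e0;
    exists e.
rewrite subspace_metric_topology; last first.
  exact: (Hn_open b_gt1 val_nontrivial Khat_completion).
have radHE A : pos_ball b valh emb A ->
    radH valh emb A = val_of_rad b (radB b valh emb A).
  move=> [a [r [r0 ->]]].
  rewrite (radH_ball b_gt1 val_nontrivial Khat_completion) //.
  by rewrite (radB_ball b_gt1 val_nontrivial Khat_completion) // ltW.
have radBE A : pos_ball b valh emb A ->
    radB b valh emb A = rad_of_val b (radH valh emb A).
  move=> pA; rewrite radHE // val_of_radK //.
  have [a [r [r0 ->]]] := pA.
  by rewrite (radB_ball b_gt1 val_nontrivial Khat_completion) // ltW.
have pf x i : Hn b valh emb n x -> pos_ball b valh emb (Defs.factor x i).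
  exact: (pos_ball_factor Khat_completion).
apply/seteqP; split; apply: metric_topology_prodS => // x i e /(pf _ i) pB e0.
(* Closeness for [dH1] gives closeness for [dB1], by continuity of the exponential. *)
- have [|e' e'0 e'P] :=
    tree_dist_continuous b_gt1 Khat_completion _ _ _ _ _ radBE _ pB e0.
    apply: continuous_comp; last exact: continuous_expR.
    by apply: continuousN; apply: continuousM; [exact: cvg_id|exact: cvg_cst].
  by exists e' => // y /(pf _ i); exact: e'P.
- have [|e' e'0 e'P] :=
    tree_dist_continuous b_gt1 Khat_completion _ _ _ _ _ radHE _ pB e0.
    apply: continuousN; apply: continuousM; last exact: cvg_cst.
    (* Conversely the logarithm is continuous at the radius of the fixed ball, which is positive on
       [Hn]. *)
    have [a [r [r0 ->]]] := pB; apply: continuous_ln.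
    by rewrite (radB_ball b_gt1 val_nontrivial Khat_completion) // ltW.
  by exists e' => // y /(pf _ i); exact: e'P.
Qed.
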